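(* $$\sum_{n=0}^{\infty}(G_n-G_{n-1})\,G_{n+1}=1+2C,$$ as formal power series in $x$.
   Context: Paths use steps $(1,1)$ and $(1,-1)$; a Dyck path of semilength $n$ starts at $(0,0)$, ends at $(2n,0)$ and never goes below level ($y$-coordinate) $0$; its height is the maximum level reached (the empty path has height $0$). Let $c(x)=\sum_{n\ge0}\frac{1}{n+1}\binom{2n}{n}x^n=\frac{1-\sqrt{1-4x}}{2x}$ and $C=c(x)-1=xc(x)^2$. For an integer $k$, $G_k=\sum_P x^{\text{semilength}(P)}$, the sum over all Dyck paths $P$ of height at most $k$ (so $G_{-1}=0$). *)

(* Defs.v *)
From HB Require Import structures.
From mathcomp Require Import all_boot all_order all_algebra.
From mathcomp Require Import boolp.

Set Implicit Arguments.
Unset Strict Implicit.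
Unset Printing Implicit Defensive.

Import Order.TTheory GRing.Theory Num.Theory.
Local Open Scope ring_scope.

(** * Formal power series *)

(** [f : fps R] stands for the series whose coefficient of x^n is [f n]. *)
Definition fps (R : Type) : Type := nat -> R.

HB.instance Definition _ (R : Type) := gen_eqMixin (fps R).
HB.instance Definition _ (R : Type) := gen_choiceMixin (fps R).

Section FpsRing.
Variable R : comNzRingType.
Implicit Types f g h : fps R.

Definition fps0 : fps R := fun=> 0.
Definition fps_opp f : fps R := fun n => - f n.
Definition fps_add f g : fps R := fun n => f n + g n.
Definition fps1 : fps R := fun n => (n == 0)%:R.
Definition fps_mul f g : fps R := fun n => \sum_(i < n.+1) f i * g (n - i)%N.

Fact fps_addA : associative fps_add.
Proof. by move=> f g h; apply/funext => n; apply: addrA. Qed.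

Fact fps_addC : commutative fps_add.
Proof. by move=> f g; apply/funext => n; apply: addrC. Qed.

Fact fps_add0 : left_id fps0 fps_add.
Proof. by move=> f; apply/funext => n; apply: add0r. Qed.

Fact fps_addN : left_inverse fps0 fps_opp fps_add.
Proof. by move=> f; apply/funext => n; apply: addNr. Qed.

HB.instance Definition _ :=
  GRing.isZmodule.Build (fps R) fps_addA fps_addC fps_add0 fps_addN.

Definition fps_trunc m f : {poly R} := \poly_(i < m.+1) f i.

Lemma coef_fps_trunc m f n : (n <= m)%N -> (fps_trunc m f)`_n = f n.
Proof. by move=> le_nm; rewrite coef_poly ltnS le_nm. Qed.

Lemma coef_fps_truncM m f g n :
  (n <= m)%N -> (fps_trunc m f * fps_trunc m g)`_n = fps_mul f g n.
Proof.
move=> le_nm; rewrite coefM; apply: eq_bigr => i _.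
rewrite !coef_fps_trunc //; first exact: leq_trans (leq_subr _ _) le_nm.
by apply: leq_trans le_nm; rewrite -ltnS.
Qed.

Fact fps_mulC : commutative fps_mul.
Proof.
by move=> f g; apply/funext => n; rewrite -!(coef_fps_truncM _ _ (leqnn n)) mulrC.
Qed.

Fact fps_mulA : associative fps_mul.
Proof.
move=> f g h; apply/funext => n.
have leS (i : 'I_n.+1) : (i <= n)%N by rewrite -ltnS.
transitivity ((fps_trunc n f * (fps_trunc n g * fps_trunc n h))`_n).
  rewrite coefM; apply: eq_bigr => i _.
  by rewrite coef_fps_trunc // coef_fps_truncM // leq_subr.
rewrite mulrA coefM; apply: eq_bigr => i _.
by rewrite coef_fps_truncM // coef_fps_trunc // leq_subr.
Qed.

Fact fps_mul1 : left_id fps1 fps_mul.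
Proof.
move=> f; apply/funext => n; rewrite /fps_mul big_ord_recl /fps1 /= mul1r subn0.
by rewrite big1 ?addr0 // => i _; rewrite mul0r.
Qed.

Fact fps_mulDl : left_distributive fps_mul fps_add.
Proof.
move=> f g h; apply/funext => n; rewrite /fps_add /fps_mul -big_split /=.
by apply: eq_bigr => i _; rewrite mulrDl.
Qed.

Fact fps1_neq0 : fps1 != fps0.
Proof.
apply/eqP => /(congr1 (fun f : fps R => f 0%N)) /eqP.
by rewrite /fps1 /fps0 /= oner_eq0.
Qed.

HB.instance Definition _ :=
  GRing.Zmodule_isComNzRing.Build (fps R)
    fps_mulA fps_mulC fps_mul1 fps_mulDl fps1_neq0.

End FpsRing.

(** [u 0 + u 1 + u 2 + ... = s] in the x-adic topology: each coefficient of the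
    partial sums is eventually constant, equal to that of [s]. *)
Definition fps_has_sum (R : comNzRingType) (u : nat -> fps R) (s : fps R) : Prop :=
  forall m : nat, exists N : nat, forall n : nat, (N <= n)%N ->
    (\sum_(i < n) u i) m = s m.

(** * Dyck paths *)

(** A path is its sequence of steps: [true] is (1,1) and [false] is (1,-1). *)
Definition rise (s : bool) : int := if s then 1 else -1.

Definition level (p : seq bool) (i : nat) : int := \sum_(s <- take i p) rise s.

Definition is_dyck (p : seq bool) : bool :=
  [forall i : 'I_(size p).+1, 0 <= level p i] && (level p (size p) == 0).

(** The default value 0 of the maximum is harmless, since [level p 0 = 0]. *)
Definition height (p : seq bool) : int :=
  \big[Num.max/0]_(i < (size p).+1) level p i.

Definition dyck_paths (n : nat) (k : int) : {set (n.*2).-tuple bool} :=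
  [set p : (n.*2).-tuple bool | is_dyck p & height p <= k].

Definition G (k : int) : fps rat := fun n => #|dyck_paths n k|%:R.

Lemma G_N1 : G (-1) = 0.
Proof.
apply/funext => n; rewrite /G (_ : dyck_paths n (-1) = set0) ?cards0 //.
apply/setP => p; rewrite !inE; apply/negbTE/nandP; right.
rewrite -ltNge (lt_le_trans (y := 0)) //.
by rewrite /height; elim/big_rec: _ => // i x _ x0; rewrite le_max x0 orbT.
Qed.

(** * The Catalan series *)

Definition c : fps rat := fun n => (n.+1)%:R^-1 * 'C(n.*2, n)%:R.

Definition C : fps rat := c - 1.

(* Main.v *)
Require Import Defs.
From mathcomp Require Import all_boot all_order all_algebra.
From mathcomp Require Import boolp zify ring.

Import Order.TTheory GRing.Theory Num.Theory.
Local Open Scope ring_scope.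

(** Write g n = G (n - 1).  First-return decomposition gives
    g (n + 1) = 1 + x g n g (n + 1), whence
      g (n + 2) g (n + 1) = g (n + 2) (1 + x g n g (n + 1))
                          = g (n + 2) + g n (g (n + 2) - 1),
    that is (g (n + 1) - g n) g (n + 2) = g (n + 2) - g n.  The series therefore
    telescopes to g (N + 1) + g N - 1, and g N tends to c.  The first-return
    relation and the limit both follow from the recursion, on the length, for
    the number of paths that end at level 0 and stay in a strip. *)

(** * Counting paths in a strip *)

(** Paths of length [m] from level [h] to level 0 that visit only the levels
    [0, ..., q - 1]. *)
Fixpoint strip_count (q h m : nat) : nat :=
  if (h < q)%N then
    if m is m'.+1 then
      (strip_count q h.+1 m' + if h is h'.+1 then strip_count q h' m' else 0)%N
    else nat_of_bool (h == 0%N)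
  else 0%N.

(** Follows the recursion of [strip_count], so that counting is an induction on the length. *)
Fixpoint in_strip (q h : nat) (p : seq bool) : bool :=
  (h < q)%N &&
  match p with
  | [::] => h == 0%N
  | true :: p' => in_strip q h.+1 p'
  | false :: p' => if h is h'.+1 then in_strip q h' p' else false
  end.

Lemma sum_tuple_cons (T : finType) (m : nat) (F : seq T -> nat) :
  (\sum_(p : m.+1.-tuple T) F p = \sum_(s : T) \sum_(p : m.-tuple T) F (s :: p))%N.
Proof.
rewrite pair_big /=.
rewrite (reindex (fun u : T * m.-tuple T => [tuple of u.1 :: u.2])) //=.
exists (fun p => (thead p, [tuple of behead p])) => [[s p] _ | p _] /=.
  by congr pair; apply: val_inj.
by rewrite [RHS]tuple_eta; apply: val_inj.
Qed.

Lemma card_in_strip (q h m : nat) :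
  #|[set p : m.-tuple bool | in_strip q h p]| = strip_count q h m.
Proof.
rewrite -sum1_card (eq_bigl (fun p : m.-tuple bool => in_strip q h p)); last first.
  by move=> p; rewrite inE.
rewrite big_mkcond /=.
elim: m h => [|m IHm] h.
  rewrite (eq_bigr (fun=> (in_strip q h [::] : nat))); last first.
    by move=> p _; rewrite tuple0; case: in_strip.
  by rewrite sum_nat_const card_tuple expn0 mul1n /=; case: ltnP.
rewrite (sum_tuple_cons bool m (fun p => if in_strip q h p then 1 else 0)%N).
rewrite big_bool /=; case: ltnP => _ /=; last by rewrite !big1.
rewrite IHm; case: h => [|h]; last by rewrite IHm.
by rewrite big1.
Qed.

(** * Levels, height and strips *)

Lemma level0 (p : seq bool) : level p 0 = 0.
Proof. by rewrite /level take0 big_nil. Qed.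

Lemma level_cons (s : bool) (p : seq bool) (i : nat) :
  level (s :: p) i.+1 = rise s + level p i.
Proof. by rewrite /level /= big_cons. Qed.

Lemma in_stripP (q h : nat) (p : seq bool) :
  reflect ((forall i, (i <= size p)%N -> 0 <= h%:Z + level p i < q%:Z)
             /\ h%:Z + level p (size p) = 0)
          (in_strip q h p).
Proof.
elim: p h => [|s p IHp] h /=.
  apply: (iffP andP) => [[hq /eqP ->] | [/(_ 0%N isT)]]; last first.
    by rewrite level0 => ? ?; split; lia.
  by split=> [i|]; rewrite ?leqn0 ?level0 // => /eqP ->; rewrite level0; lia.
(* Serves both kinds of step: dropping the first one moves the starting level from [h] to [h']. *)
have shift (h' : nat) : h'%:Z = h%:Z + rise s ->
    (h < q)%N /\ in_strip q h' p <->
    (forall i, (i <= (size p).+1)%N -> 0 <= h%:Z + level (s :: p) i < q%:Z)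
      /\ h%:Z + level (s :: p) (size p).+1 = 0.
  move=> Eh'; rewrite level_cons addrA -Eh'; split.
    move=> [hq /IHp [lev fin]]; split=> // [] [_|i /lev].
      by rewrite level0; lia.
    by rewrite level_cons addrA -Eh'.
  move=> [lev fin]; split; first by have := lev 0%N isT; rewrite level0; lia.
  by apply/IHp; split=> // i /(lev i.+1); rewrite level_cons addrA -Eh'.
case: s shift => shift.
  have [|to_lev of_lev] := shift h.+1; first by rewrite /rise; lia.
  exact: (iffP andP to_lev of_lev).
case: h shift => [|h] shift; last first.
  have [|to_lev of_lev] := shift h; first by rewrite /rise; lia.
  exact: (iffP andP to_lev of_lev).
rewrite andbF; apply: ReflectF => -[/(_ 1%N isT)].
by rewrite level_cons level0 /rise; lia.
Qed.

Lemma is_dyck_height (q : nat) (p : seq bool) :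
  is_dyck p && (height p <= q%:Z - 1) = in_strip q 0 p.
Proof.
apply/andP/in_stripP; rewrite /is_dyck /height.
  move=> [/andP[/forallP pos /eqP fin] hgt]; split; last by rewrite add0r.
  move=> i ip; rewrite add0r; have /= -> := pos (Ordinal (ip : i < (size p).+1)%N).
  have := le_trans (le_bigmax 0 (fun i : 'I_(size p).+1 => level p i)
                      (Ordinal (ip : i < (size p).+1)%N)) hgt.
  by move=> /=; lia.
rewrite add0r => -[lev ->]; split.
  by rewrite eqxx andbT; apply/forallP => i; have := lev i (ltn_ord i); lia.
(* Index 0 yields [0 < q], which bounds the default value 0 of the maximum. *)
have q0 := lev 0%N isT; rewrite level0 in q0.
apply: bigmax_le => [|i _]; first by lia.
by have := lev i (ltn_ord i); lia.
Qed.

Lemma G_strip_count (q n : nat) :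
  G (q%:Z - 1) n = (strip_count q 0 n.*2)%:R.
Proof.
rewrite /G -card_in_strip; congr (_%:R); apply: eq_card => p.
by rewrite !inE is_dyck_height.
Qed.

(** * First-return decomposition *)

Lemma strip_count_odd (q h m : nat) : odd (h + m) -> strip_count q h m = 0%N.
Proof.
elim: m h => [|m IHm] h /=; first by case: h => // h; case: ifP.
move=> hm; case: ifP => // _; rewrite IHm; last by lia.
by case: h hm => // h hm; rewrite IHm //; lia.
Qed.

Lemma strip_countS (q h m : nat) : (h < q)%N ->
  (strip_count q h m.+1 =
   strip_count q h.+1 m + if h is h'.+1 then strip_count q h' m else 0)%N.
Proof. by move=> /= ->. Qed.

Lemma strip_count_ge (q h m : nat) : (q <= h)%N -> strip_count q h m = 0%N.
Proof. by case: m => [|m] qh /=; rewrite ltnNge qh. Qed.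

(* Cut at the first visit to level 0: what precedes is a path that visits only
   the levels 1, ..., q, followed by one falling step. *)
Lemma strip_count_first_passage (q h m : nat) :
  (strip_count q.+1 h.+1 m.+1 =
   \sum_(i < m.+1) strip_count q h i * strip_count q.+1 0 (m - i))%N.
Proof.
elim: m h => [|m IHm] h.
  by rewrite big_ord1 /= ltnS; case: h => [|h]; case: q => [|q]; rewrite /= ?if_same.
have [qh|hq] := leqP q h.
  by rewrite strip_count_ge // big1 // => i _; rewrite strip_count_ge.
rewrite big_ord_recl subn0 strip_countS // IHm.
have -> : (\sum_(i < m.+1) strip_count q h (lift ord0 i)
             * strip_count q.+1 0 (m.+1 - lift ord0 i) =
           \sum_(i < m.+1) strip_count q h.+1 i * strip_count q.+1 0 (m - i) +
           \sum_(i < m.+1) (if h is h'.+1 then strip_count q h' i else 0)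
             * strip_count q.+1 0 (m - i))%N.
  rewrite -big_split; apply: eq_bigr => i _.
  by rewrite lift0 subSS strip_countS // mulnDl.
rewrite addnCA; congr addn.
(* For [h = 0] the falling step itself reaches level 0, which is the term of index 0; otherwise that
   term vanishes. *)
case: h hq => [|h] hq; last by rewrite IHm /= hq.
by rewrite [strip_count q 0 0]/= hq mul1n big1 // addn0.
Qed.

Lemma sum_even (n : nat) (F : nat -> nat) :
  (forall i, odd i -> F i = 0%N) ->
  (\sum_(i < n.*2.+1) F i = \sum_(i < n.+1) F i.*2)%N.
Proof.
move=> F_odd; elim: n => [|n IHn]; first by rewrite !big_ord1.
rewrite doubleS !big_ord_recr /= in IHn *; rewrite IHn.
by rewrite (F_odd n.*2.+1) ?addn0 //= odd_double.
Qed.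

(** The first step rises to level 1, where the first-passage formula applies; the terms of odd index
    vanish by parity. *)
Lemma strip_count_first_return (q n : nat) :
  (strip_count q.+1 0 n.+1.*2 =
   \sum_(i < n.+1) strip_count q 0 i.*2 * strip_count q.+1 0 (n - i).*2)%N.
Proof.
rewrite doubleS strip_countS // addn0.
rewrite strip_count_first_passage.
rewrite (sum_even n (fun i => strip_count q 0 i * strip_count q.+1 0 (n.*2 - i))%N).
  by apply: eq_bigr => i _; rewrite doubleB.
by move=> i io; rewrite strip_count_odd.
Qed.

Definition fpsX : fps rat := fun n => (n == 1)%:R.

Lemma coef_fpsXM (f : fps rat) (n : nat) :
  (fpsX * f) n = if n is n'.+1 then f n' else 0.
Proof.
rewrite -[LHS]/(\sum_(i < n.+1) fpsX i * f (n - i)%N); case: n => [|n].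
  by rewrite big_ord1 mul0r.
rewrite big_ord_recl mul0r add0r big_ord_recl mul1r subSS subn0.
by rewrite big1 ?addr0 // => i _; rewrite mul0r.
Qed.

Lemma G_first_return (q : nat) :
  G (q.+1%:Z - 1) = 1 + fpsX * (G (q%:Z - 1) * G (q.+1%:Z - 1)).
Proof.
apply/funext => n; rewrite -[RHS]/((n == 0)%:R + (fpsX * _) n) coef_fpsXM.
case: n => [|n]; first by rewrite G_strip_count.
rewrite add0r G_strip_count strip_count_first_return natr_sum.
by apply: eq_bigr => i _; rewrite natrM !G_strip_count.
Qed.

(** * Convergence to the Catalan series *)

Lemma strip_count_lt (q h m : nat) : (m < h)%N -> strip_count q h m = 0%N.
Proof.
elim: m h => [|m IHm] [|h] //= mh; first by case: ifP.
by rewrite !IHm ?if_same //; lia.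
Qed.

Lemma strip_count_diag (q h : nat) : (h < q)%N -> strip_count q h h = 1%N.
Proof.
elim: h => [|h IHh] hq; first by rewrite /= hq.
by rewrite strip_countS // strip_count_lt // IHh //; lia.
Qed.

(* The second summand counts, by reflection, the paths that go below
   level 0. *)
Lemma strip_count_ballot (q h b : nat) : (h + b < q)%N ->
  (strip_count q h (h + b.*2) + (if b is b'.+1 then 'C(h + b.*2, b') else 0)
   = 'C(h + b.*2, b))%N.
Proof.
(* The paths have [b] rises, so they stay at or below level [h + b] and never meet the top of the
   strip. *)
elim: b h => [|b IHb] h hq.
  by rewrite !addn0 strip_count_diag ?bin0 //; lia.
elim: h hq => [|h IHh] hq.
  have := IHb 1%N hq; rewrite !add0n doubleS add1n.
  rewrite [strip_count q 0 _]strip_countS ?addn0; last by lia.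
  have sym : 'C(b.*2.+1, b.+1) = 'C(b.*2.+1, b).
    by rewrite -bin_sub; [congr 'C(_, _) | ]; lia.
  move: (strip_count q 1 _) => w; rewrite (binS b.*2.+1 b) sym.
  case: b {IHb hq sym} => [|b]; first by rewrite !bin0; lia.
  by rewrite (binS b.+1.*2.+1 b); lia.
(* A first rise leaves [b] rises from [h.+2]; a first fall leaves [b.+1] rises from [h]. Pascal's
   rule combines the two. *)
have IHb' := IHb h.+2 ltac:(lia); have IHh' := IHh ltac:(lia).
move: IHb' IHh'; rewrite (_ : h.+2 + b.*2 = (h + b.*2).+2)%N; last by lia.
rewrite (_ : h + b.+1.*2 = (h + b.*2).+2)%N; last by lia.
rewrite (_ : h.+1 + b.+1.*2 = (h + b.*2).+3)%N; last by lia.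
rewrite [strip_count q h.+1 _]strip_countS; last by lia.
case: b {IHb IHh hq} => [|b].
  by rewrite !bin0 !bin1; lia.
move: (h + _)%N => m; rewrite !(binS m.+2).
by lia.
Qed.

Lemma catalan_strip_count (q n : nat) : (n < q)%N ->
  (n.+1 * strip_count q 0 n.*2 = 'C(n.*2, n))%N.
Proof.
move=> nq; have := strip_count_ballot q 0 n nq; rewrite add0n.
case: n nq => [|n] nq; first by lia.
(* This gives the ratio of the two binomials in the ballot formula. *)
have := mul_bin_left n.+1.*2 n.
rewrite (_ : n.+1.*2 - n = n.+2)%N; last by lia.
by nia.
Qed.

(** A path of semilength [n] has height at most [n], so the bound [q - 1] excludes none. *)
Lemma G_catalan (q n : nat) : (n < q)%N -> G (q%:Z - 1) n = c n.
Proof.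
move=> nq; rewrite G_strip_count /c -(catalan_strip_count q n nq) natrM mulKr //.
by rewrite unitfE pnatr_eq0.
Qed.

(** * Telescoping *)

Lemma sum_G (n : nat) :
  \sum_(i < n) (G i%:Z - G (i%:Z - 1)) * G (i%:Z + 1)
  = G (n.+1%:Z - 1) + G (n%:Z - 1) - 1.
Proof.
elim: n => [|n IHn].
  by rewrite big_ord0 G_first_return G_N1 mul0r mulr0 !addr0 subrr.
rewrite big_ord_recr IHn /=.
(* All indices are put in the form [q - 1] of the first-return relation. *)
have -> : n%:Z + 1 = n.+2%:Z - 1 by lia.
have -> : n%:Z = n.+1%:Z - 1 :> int by lia.
have -> : n.+1%:Z - 1 - 1 = n%:Z - 1 by lia.
have := G_first_return n; have := G_first_return n.+1.
move: (G (n.+2%:Z - 1)) (G (n.+1%:Z - 1)) (G (n%:Z - 1)) => g2 g1 g0 E2 E1.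
have -> : (g1 - g0) * g2 = g2 - g0.
  have : g1 * g2 = g2 + g0 * (fpsX * (g1 * g2)) by rewrite {1}E1; ring.
  have -> : fpsX * (g1 * g2) = g2 - 1 by rewrite {2}E2; ring.
  by rewrite mulrBl => ->; ring.
ring.
Qed.

Theorem theorem3p2 :
  fps_has_sum (fun n : nat => (G n%:Z - G (n%:Z - 1)) * G (n%:Z + 1))
    (1 + 2 * C).
Proof.
(* Once [n > m], both series of the telescoped sum agree with [c] at [m]. *)
move=> m; exists m.+1 => n mn; rewrite sum_G.
have -> : 1 + 2 * C = c + c - 1 by rewrite /C; ring.
by congr (_ + _ - _); apply: G_catalan; lia.
Qed.
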